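(* Let $\mathcal{G}=(\mathcal{V},\mathcal{A})$ be any information-flow graph, representing a single-uniprior index coding problem. Execute the Pruning Algorithm on $\mathcal{G}$ (with any choices), obtaining a graph $\mathcal{G}'=(\mathcal{V}',\mathcal{A}')$ with non-trivial strongly connected components $\mathcal{G}'_{\mathrm{sub},1},\dots,\mathcal{G}'_{\mathrm{sub},N_{\mathrm{sub}}}$, and let $\mathcal{G}'_{\mathrm{sub}}=(\mathcal{V}'_{\mathrm{sub}},\mathcal{A}'_{\mathrm{sub}})=\bigcup_{i=1}^{N_{\mathrm{sub}}}\mathcal{G}'_{\mathrm{sub},i}$. Then $$\ell^*(\mathcal{G})=\sum_{i=1}^{N_{\mathrm{sub}}}\bigl(V(\mathcal{G}'_{\mathrm{sub},i})-1\bigr)+A(\mathcal{G}'\setminus\mathcal{G}'_{\mathrm{sub}}),$$ where $A(\mathcal{G}'\setminus\mathcal{G}'_{\mathrm{sub}})=|\mathcal{A}'\setminus\mathcal{A}'_{\mathrm{sub}}|$.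
   Context: Single-uniprior index coding problem: a sender holds $n$ message bits $x_1,\dots,x_n\in\{0,1\}$ (independent, uniformly distributed), and there are $n$ receivers; receiver $j$ knows exactly the bit $x_j$ a priori and wants a set $\mathcal{W}_j$ of message bits, $x_j\notin\mathcal{W}_j$. The problem is represented by its information-flow graph, the finite directed graph $\mathcal{G}=(\mathcal{V},\mathcal{A})$ with $\mathcal{V}=\{1,\dots,n\}$ and with an arc $(i,j)\in\mathcal{A}$ (tail $i$, head $j$) if and only if $x_i\in\mathcal{W}_j$. Standing assumptions on information-flow graphs: no loops, at most one arc for each ordered pair of vertices (both $(i,j)$ and $(j,i)$ may be present), and every vertex is incident with at least one arc, so there are at least two vertices and at least one arc. An index code of length $\ell$ for $\mathcal{G}$ consists of an encoding function $E:\{0,1\}^n\to\{0,1\}^\ell$ and, for each receiver $j$, a decoding function $D_j:\{0,1\}^{\ell+1}\to\{0,1\}^{|\mathcal{W}_j|}$ such that $D_j(E(x),x_j)=(x_i)_{i:(i,j)\in\mathcal{A}}$ for every $x=(x_1,\dots,x_n)\in\{0,1\}^n$. $\ell^*(\mathcal{G})$ is the smallest integer $\ell$ for which an index code of length $\ell$ exists. $V(\cdot)$ and $A(\cdot)$ denote the number of vertices and of arcs. A cycle is a directed cycle with distinct vertices (at least two; two opposite arcs form a cycle). A graph is strongly connected if there is a directed path from $u$ to $v$ for every ordered pair of distinct vertices; strongly connected components are the maximal strongly connected subgraphs; a component is non-trivial if it has at least two vertices. Unions of graphs are taken on vertex sets and arc sets, and $\mathcal{G}_1\setminus\mathcal{G}_2$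 denotes the pair of set differences of the vertex sets and of the arc sets (it need not be a graph). Pruning Algorithm. Initialize $\mathcal{G}'=(\mathcal{V}',\mathcal{A}')\leftarrow\mathcal{G}$. Step 1: while there is a vertex $i\in\mathcal{V}'$ that (in the current $\mathcal{G}'$) has more than one outgoing arc and has an outgoing arc that does not belong to any cycle of $\mathcal{G}'$, choose such a vertex $i$ and any such arc $(i,j)$, and remove from $\mathcal{G}'$ all outgoing arcs of $i$ except $(i,j)$. Step 2: label the non-trivial strongly connected components of the resulting $\mathcal{G}'$ as $\mathcal{G}'_{\mathrm{sub},1},\dots,\mathcal{G}'_{\mathrm{sub},N_{\mathrm{sub}}}$ (with $N_{\mathrm{sub}}\ge 0$). *)

(* Defs.v *)
From mathcomp Require Import all_boot.

Set Implicit Arguments.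
Unset Strict Implicit.
Unset Printing Implicit Defensive.

(* A raw pair of a vertex set and an arc set, so that set differences of graphs
   live in the same type; [wf_digraph] singles out the genuine graphs.  The arc
   with tail i and head j is the pair (i, j). *)
Definition digraph (T : finType) : Type := ({set T} * {set T * T})%type.

Section Digraphs.
Variable T : finType.
Implicit Types (G H K : digraph T) (S : {set digraph T}) (i j : T).

Definition verts G : {set T} := G.1.
Definition arcs G : {set T * T} := G.2.
Definition arc_rel G : rel T := [rel i j | (i, j) \in arcs G].

Definition wf_digraph G : bool :=
  [forall a in arcs G, (a.1 \in verts G) && (a.2 \in verts G)].

Definition digraph_union S : digraph T :=
  (\bigcup_(H in S) verts H, \bigcup_(H in S) arcs H).

Definition digraph_diff G H : digraph T :=
  (verts G :\: verts H, arcs G :\: arcs H).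

Definition subgraph H G : bool :=
  [&& wf_digraph H, verts H \subset verts G & arcs H \subset arcs G].

Definition strongly_connected G : bool :=
  [forall u in verts G, forall v in verts G,
     (u != v) ==> connect (arc_rel G) u v].

Definition scc G H : bool :=
  [&& subgraph H G, strongly_connected H &
   [forall K : digraph T,
      [&& subgraph K G, strongly_connected K & subgraph H K] ==> (K == H)]].

Definition nontrivial_sccs G : {set digraph T} :=
  [set H : digraph T | scc G H & 1 < #|verts H|].

Definition on_cycle G i j : Prop :=
  exists c : seq T,
    [/\ 1 < size c, ucycle (arc_rel G) c, i \in c & next c i = j].

Definition out_arcs G i : {set T * T} := [set a in arcs G | a.1 == i].

Definition prune_at G i j : digraph T :=
  (verts G, arcs G :\: (out_arcs G i :\ (i, j))).

Definition prunable G i j : Prop :=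
  [/\ i \in verts G, 1 < #|out_arcs G i|, (i, j) \in arcs G
    & ~ on_cycle G i j].

(* [pruning G G']: some terminating run of the pruning loop leads from G to G'. *)
Inductive pruning : digraph T -> digraph T -> Prop :=
| pruning_stop G : (forall i j, ~ prunable G i j) -> pruning G G
| pruning_step G i j G' :
    prunable G i j -> pruning (prune_at G i j) G' -> pruning G G'.

End Digraphs.

(* At most one arc per ordered pair is built into [digraph]. *)
Definition information_flow_graph n (G : digraph 'I_n) : Prop :=
  [/\ 0 < n,
      verts G = [set: 'I_n],
      forall i, (i, i) \notin arcs G
    & forall i, exists j, (i, j) \in arcs G \/ (j, i) \in arcs G].

Section IndexCoding.
Variables (n : nat) (G : digraph 'I_n).

Definition wanted (j : 'I_n) : {set 'I_n} := [set i | (i, j) \in arcs G].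

Definition wanted_bits (x : n.-tuple bool) (j : 'I_n) :
    #|wanted j|.-tuple bool :=
  [tuple tnth x (enum_val k) | k < #|wanted j|].

Definition encoder l := {ffun n.-tuple bool -> l.-tuple bool}.
Definition decoders l :=
  {dffun forall j : 'I_n,
     {ffun l.+1.-tuple bool -> #|wanted j|.-tuple bool}}.

Definition is_index_code l (E : encoder l) (D : decoders l) : bool :=
  [forall x : n.-tuple bool, forall j : 'I_n,
     D j (rcons_tuple (E x) (tnth x j)) == wanted_bits x j].

Definition has_index_code l : bool :=
  [exists E : encoder l, exists D : decoders l, is_index_code E D].

Lemma has_index_code_exists : exists l, has_index_code l.
Proof.
exists n; apply/existsP; exists [ffun x => x].
apply/existsP.
exists (@finfun _ (fun j : 'I_n =>
          {ffun n.+1.-tuple bool -> #|wanted j|.-tuple bool})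
  (fun j => [ffun y : n.+1.-tuple bool =>
     [tuple tnth y (widen_ord (leqnSn n) (enum_val k))
       | k < #|wanted j|]])).
apply/forallP => x; apply/forallP => j; rewrite !ffunE.
apply/eqP/eq_from_tnth => k; rewrite !tnth_mktuple.
by rewrite !(tnth_nth false) /= nth_rcons size_tuple ltn_ord.
Qed.

Definition opt_length : nat := ex_minn has_index_code_exists.

End IndexCoding.

(* Main.v *)
Require Import Defs.
From mathcomp Require Import all_boot.

Set Implicit Arguments.
Unset Strict Implicit.
Unset Printing Implicit Defensive.

(** In a fully pruned graph the non-trivial strongly connected components have
    no outgoing arcs, and every other vertex has at most one outgoing arc.  Fix
    a representative in each such component, and let K be the set of vertices
    that have an outgoing arc and are not representatives; the right-hand side
    of the formula is |K|.
    Lower bound: every vertex has a directed path to a vertex outside K (a sink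
    or a representative), and a bit known together with the codeword gives the
    bits at the in-neighbours of its vertex; so the codeword and the bits outside
    K determine all bits, and the code separates the messages supported in K.
    Upper bound: for i in K, send x_i plus the representative's bit if i is in a
    non-trivial component, and x_i itself otherwise.  This also serves the arcs
    deleted by pruning, because their tails lie on no cycle afterwards and are
    therefore sent uncoded. *)

(** * Strongly connected components and their representatives *)

Section Components.
Variables (T : finType) (G : digraph T).
Implicit Types (H : digraph T) (i j u v w : T).

Notation e := (arc_rel G).

Definition comp v : {set T} := [set u | connect e v u && connect e u v].

Definition induced_scc v : digraph T :=
  (comp v, [set a in arcs G | (a.1 \in comp v) && (a.2 \in comp v)]).

Definition cyclic_verts : {set T} := [set v | 1 < #|comp v|].

(** The choice depends only on the set [comp v], so a component has a single representative; the
    default is never reached, as [v] lies in [comp v]. *)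
Definition rep v : T := odflt v [pick u in comp v].

Definition coded_verts : {set T} :=
  [set i | [exists j, (i, j) \in arcs G]
           && ~~ ((i \in cyclic_verts) && (rep i == i))].

Lemma comp_refl v : v \in comp v.
Proof. by rewrite inE connect0. Qed.

Lemma comp_eq u v : u \in comp v -> comp u = comp v.
Proof.
rewrite inE => /andP[vu uv]; apply/setP => w; rewrite !inE.
apply/andP/andP => -[a b]; split.
- exact: connect_trans vu a.
- exact: connect_trans b uv.
- exact: connect_trans uv a.
- exact: connect_trans b vu.
Qed.

Lemma comp_cyclic u v :
  u \in comp v -> (u \in cyclic_verts) = (v \in cyclic_verts).
Proof. by move=> uv; rewrite !inE (comp_eq uv). Qed.

Lemma rep_in v : rep v \in comp v.
Proof.
rewrite /rep; case: pickP => [//|none].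
by have:= none v; rewrite /= comp_refl.
Qed.

Lemma rep_eq u v : u \in comp v -> rep u = rep v.
Proof.
move=> uv; rewrite /rep (comp_eq uv); case: pickP => [//|none].
by have:= none v; rewrite /= comp_refl.
Qed.

Lemma rep_rep v : rep (rep v) = rep v.
Proof. exact/rep_eq/rep_in. Qed.

Lemma cyclic_vertsP v :
  reflect (exists2 u, u != v & u \in comp v) (v \in cyclic_verts).
Proof.
rewrite inE (cardsD1 v) comp_refl ltnS card_gt0.
apply: (iffP (set0Pn _)) => [[u]|[u uv uC]].
  by rewrite !inE => /andP[]; exists u; rewrite ?inE.
by exists u; rewrite in_setD1 uv.
Qed.

(** The out-arc condition is automatic: a path to another vertex of the component starts with an arc
    out of [v]. *)
Lemma coded_cyclic v :
  v \in cyclic_verts -> (v \in coded_verts) = (rep v != v).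
Proof.
move=> vS; rewrite inE vS; case: existsP => // -[].
have /cyclic_vertsP[u uv] := vS.
rewrite inE => /andP[/connectP[[|k p] /= ep uE] _].
  by rewrite uE eqxx in uv.
by exists k; case/andP: ep.
Qed.

(** A path with both ends in a component stays inside it: each vertex on it is reachable from [v]
    and reaches [v]. *)
Lemma connect_induced v p u :
    path e u p -> u \in comp v -> last u p \in comp v ->
  connect (arc_rel (induced_scc v)) u (last u p).
Proof.
elim: p u => [|w p IHp] u /=; first by rewrite connect0.
move=> /andP[uw wp] uC lC.
have wl : connect e w (last w p) by apply/connectP; exists p.
have wC : w \in comp v.
  move: (uC) (lC); rewrite !inE => /andP[vu _] /andP[_ lv].
  by rewrite (connect_trans vu (connect1 uw)) (connect_trans wl lv).
apply: connect_trans (IHp _ wp wC lC); apply: connect1.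
have: (u, w) \in arcs (induced_scc v) by rewrite inE /= uC wC !andbT.
by [].
Qed.

Lemma induced_scc_sc v : strongly_connected (induced_scc v).
Proof.
apply/forall_inP => u uC; apply/forall_inP => w wC; apply/implyP => _.
have /connectP[p ep wE] : connect e u w.
  move: uC wC; rewrite !inE => /andP[_ uv] /andP[vw _].
  exact: connect_trans uv vw.
by rewrite wE in wC *; apply: connect_induced ep uC wC.
Qed.

Lemma sc_sub_induced H v :
    subgraph H G -> strongly_connected H -> v \in verts H ->
  verts H \subset comp v /\ arcs H \subset arcs (induced_scc v).
Proof.
move=> /and3P[/forall_inP wfH _ aH] /forall_inP scH vH.
have HG : subrel (connect (arc_rel H)) (connect e).
  by apply: connect_sub => a b ab; apply/connect1/(subsetP aH).
have con a b : a \in verts H -> b \in verts H -> connect e a b.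
  move=> aV bV; have [->|ab] := eqVneq a b; first exact: connect0.
  by apply: HG; have /forall_inP/(_ b bV)/implyP := scH a aV; apply.
have sV : verts H \subset comp v.
  by apply/subsetP => u uH; rewrite inE !con.
split=> //; apply/subsetP => a aA.
have /andP[a1 a2] := wfH a aA.
by rewrite inE (subsetP aH) // !(subsetP sV).
Qed.

Lemma induced_scc_sub v : verts G = [set: T] -> subgraph (induced_scc v) G.
Proof.
move=> vG; apply/and3P; split.
- by apply/forall_inP => a; rewrite inE => /andP[].
- by rewrite vG subsetT.
- by apply/subsetP => a; rewrite inE => /andP[].
Qed.

Lemma nontrivial_sccsE :
  verts G = [set: T] -> nontrivial_sccs G = induced_scc @: cyclic_verts.
Proof.
move=> vG; apply/setP => H; rewrite inE; apply/andP/imsetP => [|[v vS ->]].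
  case=> /and3P[sH scH /forallP maxH] H1.
  have /card_gt0P[v vH] : 0 < #|verts H| by apply: leq_trans H1.
  have [sV sA] := sc_sub_induced sH scH vH.
  have /eqP HE : induced_scc v == H.
    apply: (implyP (maxH (induced_scc v))).
    rewrite induced_scc_sub // induced_scc_sc.
    by case/and3P: sH => wfH _ _; rewrite /subgraph wfH sV.
  by exists v => //; rewrite inE; rewrite -HE in H1.
split; last by rewrite inE in vS.
rewrite /scc induced_scc_sub // induced_scc_sc /=.
apply/forallP => K; apply/implyP => /and3P[sK scK /and3P[_ vIK aIK]].
have [vKI aKI] := sc_sub_induced sK scK (subsetP vIK v (comp_refl v)).
case: K => VK AK /= in vIK aIK vKI aKI sK scK *.
by apply/eqP; congr pair; apply/eqP; rewrite eqEsubset ?vKI ?aKI.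
Qed.

Lemma sum_nontrivial_sccs :
    verts G = [set: T] ->
  \sum_(H in nontrivial_sccs G) (#|verts H| - 1)
    = #|[set v in cyclic_verts | rep v != v]|.
Proof.
move=> vG; rewrite nontrivial_sccsE // -sum1_card.
rewrite (partition_big induced_scc [in induced_scc @: cyclic_verts]) /=;
  last first.
  by move=> v; rewrite inE => /andP[vS _]; apply: imset_f.
apply: eq_bigr => H /imsetP[w wS ->].
(* Each fibre is a component without its representative, hence the subtracted 1. *)
rewrite /verts /= (cardsD1 (rep w)) rep_in add1n subn1 /= -sum1_card.
apply: eq_bigl => v; rewrite inE in_setD1.
apply/andP/andP => [[vw vC]|[/andP[vS rv] /eqP[vw _]]].
  rewrite (comp_cyclic vC) wS (rep_eq vC) eq_sym vw.
  by rewrite /induced_scc (comp_eq vC).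
have vC : v \in comp w by rewrite -vw comp_refl.
by rewrite vC -(rep_eq vC) eq_sym.
Qed.

End Components.

(** * Cycles and arcs removed in a pruning run *)

Section Pruned.
Variable T : finType.
Implicit Types (G H : digraph T) (i j u v : T).

Definition loopless G := forall i, (i, i) \notin arcs G.

Lemma next_at_last (y0 y : T) p :
  uniq (y :: p) -> next_at (last y p) y0 y p = y0.
Proof.
elim: p y => [|z p IHp] y /=; first by rewrite eqxx.
move=> /andP[yzp zp]; rewrite (IHp z zp) ifN //.
by apply: contraNneq yzp => <-; rewrite mem_last.
Qed.

(** A path from the head back to the tail, made simple, closes with the arc into a cycle;
    looplessness excludes length one. *)
Lemma on_cycleP G i j :
  loopless G -> (i, j) \in arcs G -> on_cycle G i j <-> connect (arc_rel G) j i.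
Proof.
move=> nG ij; split=> [[c [_ /andP[cyc _] ic nc]]|/connectP[p0 ep0 iE]].
  by apply: (connect_cycle cyc) => //; rewrite -nc mem_next.
case/shortenP: ep0 iE => p ep up _ iE.
exists (j :: p); split.
- case: p iE {ep up} => //= iE; move: ij; rewrite iE => jj.
  by have := nG j; rewrite jj.
- by rewrite /ucycle /= rcons_path ep -iE [arc_rel _ _ _]ij.
- by rewrite iE mem_last.
- by rewrite iE; apply: next_at_last.
Qed.

Lemma prune_at_arcs G i j : arcs (prune_at G i j) \subset arcs G.
Proof. exact: subsetDl. Qed.

Lemma pruning_sub G G' :
  pruning G G' -> verts G' = verts G /\ arcs G' \subset arcs G.
Proof.
elim=> [//|{}G i j {}G' _ _ [vE sA]]; split=> //.
exact: subset_trans sA (prune_at_arcs _ _ _).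
Qed.

Lemma pruning_stable G G' : pruning G G' -> forall i j, ~ prunable G' i j.
Proof. by elim. Qed.

Lemma loopless_sub G H : arcs H \subset arcs G -> loopless G -> loopless H.
Proof. by move=> sA nG i; apply: contra (nG i); apply: subsetP. Qed.

Lemma connect_arcs_sub G H :
    arcs H \subset arcs G ->
  subrel (connect (arc_rel H)) (connect (arc_rel G)).
Proof.
by move=> sA; apply: connect_sub => a b ab; apply/connect1/(subsetP sA).
Qed.

(** The step that removes the arc keeps a sibling lying on no cycle. If the sibling survives to the
    end, it is the witness, since later graphs only lose arcs; if it is removed later, induction
    applies to it. *)
Lemma pruning_removed G G' i k :
    pruning G G' -> loopless G -> (i, k) \in arcs G -> (i, k) \notin arcs G' ->
  exists2 j, (i, j) \in arcs G' & ~~ connect (arc_rel G') j i.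
Proof.
move=> pG; elim: pG k => [{}G _ k _ ->//|].
move=> {}G a b {}G' [_ _ ab ncyc] pG IH k nG ik nik.
have sG := prune_at_arcs G a b; have nG1 := loopless_sub sG nG.
have [ik1|nik1] := boolP ((i, k) \in arcs (prune_at G a b)).
  exact: IH ik1 nik.
have {nik1}ia : i = a.
  by move: nik1; rewrite !inE ik /= andbT negbK => /andP[_ /eqP].
rewrite {i}ia in ik nik IH *.
have ab1 : (a, b) \in arcs (prune_at G a b) by rewrite !inE eqxx ab.
have [_ sG'] := pruning_sub pG.
have [ab'|nab'] := boolP ((a, b) \in arcs G'); last exact: IH ab1 nab'.
exists b => //; apply/negP => /(connect_arcs_sub (subset_trans sG' sG)) ba.
by apply: ncyc; apply/on_cycleP.
Qed.

(** * Graphs to which no pruning step applies *)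

Section Stable.
Variable G : digraph T.
Hypotheses (vG : verts G = [set: T]) (nG : loopless G).
Hypothesis stableG : forall i j, ~ prunable G i j.

Notation e := (arc_rel G).

(** Otherwise [i] would have a second outgoing arc besides [(i, j)], which lies on no cycle, and
    pruning could continue. *)
Lemma stable_out i j k :
  (i, j) \in arcs G -> ~~ connect e j i -> (i, k) \in arcs G -> k = j.
Proof.
move=> ij nji ik; apply/eqP/idPn => kj; apply: (stableG (i := i) (j := j)).
split=> //; first by rewrite vG inE.
  rewrite (cardsD1 (i, j)) inE ij eqxx add1n ltnS card_gt0.
  by apply/set0Pn; exists (i, k);
    rewrite !inE ik eqxx xpair_eqE (negPf kj) andbF.
by move=> /(on_cycleP nG ij); apply/negP.
Qed.

(** If [(i, j)] lay on no cycle, it would be the only arc out of [i], so a closed walk from [i]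
    through another vertex would begin with it and lead from [j] back to [i]. *)
Lemma stable_cyclic i j :
  (i, j) \in arcs G -> (i \in cyclic_verts G) = connect e j i.
Proof.
move=> ij; apply/idP/idP => [/cyclic_vertsP[u ui]|ji].
  rewrite inE => /andP[/connectP[[|k p] /= ep uE] ui'].
    by rewrite uE eqxx in ui.
  case/andP: ep => ik kp; apply/idPn => nji; case/negP: (nji).
  rewrite (stable_out ij nji ik) in kp uE.
  by apply: connect_trans ui'; apply/connectP; exists p.
apply/cyclic_vertsP; exists j; last by rewrite inE ji connect1.
by apply: contraTneq ij => ->.
Qed.

Lemma stable_comp i j :
  (i, j) \in arcs G -> i \in cyclic_verts G -> j \in comp G i.
Proof. by move=> ij; rewrite (stable_cyclic ij) inE => ->; rewrite connect1. Qed.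

Lemma arcs_diff_sccs :
  arcs (digraph_diff G (digraph_union (nontrivial_sccs G)))
    = [set a in arcs G | a.1 \notin cyclic_verts G].
Proof.
apply/setP => -[i j]; rewrite nontrivial_sccsE // in_setD [RHS]inE /= andbC.
have [ij /=|//] := boolP ((i, j) \in arcs G); congr (~~ _).
apply/bigcupP/idP => [[H /imsetP[v vS ->]]|iS].
  by rewrite inE => /and3P[_ /= iv _]; rewrite (comp_cyclic iv).
exists (induced_scc G i); first exact: imset_f.
by rewrite inE ij comp_refl stable_comp.
Qed.

Lemma card_coded_verts :
  \sum_(H in nontrivial_sccs G) (#|verts H| - 1)
    + #|arcs (digraph_diff G (digraph_union (nontrivial_sccs G)))|
  = #|coded_verts G|.
Proof.
rewrite sum_nontrivial_sccs // arcs_diff_sccs.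
rewrite -(cardsID (cyclic_verts G) (coded_verts G)); congr (_ + _).
  apply: eq_card => i; rewrite in_setI [LHS]inE andbC.
  by case: (boolP (i \in cyclic_verts G)) => [/coded_cyclic->|_];
    rewrite ?andbF.
(* Outside the non-trivial components a tail has only one outgoing arc, so these arcs can be counted
   by their tails. *)
rewrite -(card_in_imset (f := fst)) => [|[i j] [i' k] /=].
  apply: eq_card => i; rewrite in_setD [i \in coded_verts G]inE.
  apply/imsetP/andP => [[[i' j]]|[iS /andP[/existsP[j ij] _]]].
    rewrite inE /= => /andP[ij iS] ->; rewrite (negPf iS); split=> //.
    by rewrite andbT; apply/existsP; exists j.
  by exists (i, j); rewrite // inE ij.
rewrite !in_set /= => /andP[ij iS] /andP[i'k _] ii'; rewrite -ii' in i'k *.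
have nji : ~~ connect e j i by rewrite -(stable_cyclic ij) inE.
by rewrite (stable_out ij nji i'k).
Qed.

Lemma connect_uncoded i :
  exists2 r, connect e i r & r \notin coded_verts G.
Proof.
have [m] := ubnP #|connect e i|; elim: m i => // m IH i im.
have [iK|niK] := boolP (i \in coded_verts G); last by exists i.
have [iS|niS] := boolP (i \in cyclic_verts G).
  exists (rep G i); first by have:= rep_in G i; rewrite inE => /andP[].
  by rewrite inE (comp_cyclic (rep_in G i)) iS rep_rep eqxx andbF.
move: iK; rewrite inE => /andP[/existsP[j ij] _].
have [r jr nr] : exists2 r, connect e j r & r \notin coded_verts G.
  (* The induction is on the number of reachable vertices, which drops because [i] is not reachable
     from [j]. *)
  rewrite ltnS in im; apply: IH; apply: leq_trans im.
  apply: proper_card; apply/properP; split.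
    by apply/subsetP => u; apply: connect_trans; apply: connect1.
  by exists i; [exact: connect0 | rewrite -topredE /= -(stable_cyclic ij)].
by exists r => //; apply: connect_trans jr; apply: connect1.
Qed.

End Stable.
End Pruned.

(** * Index codes and the lower bound *)

Section Codes.
Variables (n : nat) (G : digraph 'I_n).
Implicit Types (x y : n.-tuple bool) (i j r : 'I_n) (l : nat).

(** Decoder-free form of an index code: the codeword and the known bit determine the wanted bits. *)
Definition decodable l (E : n.-tuple bool -> l.-tuple bool) : Prop :=
  forall x y j, E x = E y -> tnth x j = tnth y j ->
  forall i, (i, j) \in arcs G -> tnth x i = tnth y i.

Lemma has_index_codeP l :
  has_index_code G l <->
  exists E : n.-tuple bool -> l.-tuple bool, decodable E.
Proof.
split=> [/existsP[E /existsP[D /forallP codeD]]|[E decE]].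
  exists E => x y j Exy xyj i ij.
  have /eqP Dx := forallP (codeD x) j; have /eqP Dy := forallP (codeD y) j.
  have iW : i \in wanted G j by rewrite inE.
  rewrite Exy xyj {}Dy in Dx.
  have := congr1 (fun t => tnth t (enum_rank_in iW i)) Dx.
  by rewrite !tnth_mktuple enum_rankK_in.
apply/existsP; exists [ffun x => E x]; apply/existsP.
(* Decode with any message compatible with the received data; the default arises only for inputs
   that no message produces. *)
exists (@finfun _ (fun j : 'I_n =>
          {ffun l.+1.-tuple bool -> #|wanted G j|.-tuple bool})
  (fun j => [ffun c : l.+1.-tuple bool =>
     if [pick x | rcons_tuple (E x) (tnth x j) == c] is Some x
     then wanted_bits G x j else [tuple false | _ < #|wanted G j|]])).
apply/forallP => x; apply/forallP => j; rewrite !ffunE.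
case: pickP => [y|/(_ x)]; last by rewrite eqxx.
rewrite -val_eqE /= eqseq_rcons val_eqE => /andP[/eqP Eyx /eqP yxj].
apply/eqP/eq_from_tnth => k; rewrite !tnth_mktuple.
by apply: (decE y x j Eyx yxj); have := enum_valP k; rewrite inE.
Qed.

Lemma decodable_connect l (E : n.-tuple bool -> l.-tuple bool) x y i r :
    decodable E -> E x = E y -> connect (arc_rel G) i r ->
  tnth x r = tnth y r -> tnth x i = tnth y i.
Proof.
move=> decE Exy /connectP[p ep ->]; elim: p i ep => //= j p IHp i /andP[ij jp].
by move=> /(IHp j jp) xyj; apply: decE Exy xyj _ ij.
Qed.

Lemma index_code_lower l :
    verts G = [set: 'I_n] -> loopless G -> (forall i j, ~ prunable G i j) ->
  has_index_code G l -> #|coded_verts G| <= l.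
Proof.
move=> vG nG stG /has_index_codeP[E decE].
(* [msg A] is the indicator of [A], so subsets of [K] stand for the messages supported in [K]. *)
pose K := coded_verts G; pose msg (A : {set 'I_n}) := [tuple i \in A | i < n].
have injE : {in powerset K &, injective (E \o msg)}.
  move=> A B; rewrite !inE => AK BK EAB; apply/setP => i.
  have [r ir nrK] := connect_uncoded vG nG stG i.
  have := decodable_connect decE EAB ir; rewrite !tnth_mktuple; apply.
  have out (C : {set 'I_n}) : C \subset K -> r \in C = false.
    by move=> CK; apply: contraNF nrK; apply: subsetP.
  by rewrite !out.
have := max_card [in (E \o msg) @: powerset K].
by rewrite card_in_imset // card_powerset card_tuple card_bool leq_exp2l.
Qed.

End Codes.

(** * Upper bound and the formula *)

Lemma has_index_code_sub n (G H : digraph 'I_n) l :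
  arcs H \subset arcs G -> has_index_code G l -> has_index_code H l.
Proof.
move=> /subsetP sA /has_index_codeP[E decE]; apply/has_index_codeP.
by exists E => x y j Exy xyj i /sA; apply: decE Exy xyj i.
Qed.

Lemma pruning_code n (G G' : digraph 'I_n) :
    verts G = [set: 'I_n] -> loopless G -> pruning G G' ->
  has_index_code G #|coded_verts G'|.
Proof.
move=> vG nG pG; have [vE sA] := pruning_sub pG; rewrite vG in vE.
have nG' := loopless_sub sA nG; have stG' := pruning_stable pG.
pose S := cyclic_verts G'; pose K := coded_verts G'.
pose bit (x : n.-tuple bool) i := tnth x i (+) ((i \in S) && tnth x (rep G' i)).
apply/has_index_codeP.
exists (fun x => [tuple bit x (enum_val k) | k < #|K|]) => x y j Exy xyj i ij.
have bitK v : v \in K -> bit x v = bit y v.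
  move=> vK; have := congr1 (fun t => tnth t (enum_rank_in vK v)) Exy.
  by rewrite !tnth_mktuple enum_rankK_in.
(* Nothing is sent for a representative, but its [bit] is a bit added to itself, hence always
   zero. *)
have bitS v : v \in S -> bit x v = bit y v.
  move=> vS; have [/bitK//|] := boolP (v \in K).
  by rewrite coded_cyclic // negbK /bit vS => /eqP->; rewrite !addbb.
have uncoded k : (i, k) \in arcs G' -> i \notin S -> tnth x i = tnth y i.
  move=> ik niS; have := bitK i; rewrite /bit (negPf niS) !addbF; apply.
  by rewrite inE [i \in cyclic_verts _](negPf niS) andbT;
    apply/existsP; exists k.
have [ij'|nij'] := boolP ((i, j) \in arcs G'); last first.
  have [k ik nki] := pruning_removed pG nG ij nij'.
  by apply: (uncoded k ik); rewrite /S (stable_cyclic vE nG' stG' ik).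
have [iS|] := boolP (i \in S); last exact: uncoded ij'.
have jC := stable_comp vE nG' stG' ij' iS.
have jS : j \in S by rewrite /S (comp_cyclic jC).
(* The known bit of [j] and the sum at [j] reveal the representative's bit, which then unmasks the
   bit of [i]. *)
have := bitS i iS; have := bitS j jS; rewrite /bit iS jS (rep_eq jC) xyj.
by move=> /addbI->; apply: addIb.
Qed.

Theorem theorem3 (n : nat) (G G' : digraph 'I_n)
    (hG : information_flow_graph G) (hG' : pruning G G') :
  opt_length G =
    \sum_(H in nontrivial_sccs G') (#|verts H| - 1)
    + #|arcs (digraph_diff G' (digraph_union (nontrivial_sccs G')))|.
Proof.
have [_ vG nG _] := hG; have [vE sA] := pruning_sub hG'; rewrite vG in vE.
have nG' := loopless_sub sA nG; have stG' := pruning_stable hG'.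
rewrite card_coded_verts // /opt_length; case: ex_minnP => l codel minl.
apply/eqP; rewrite eqn_leq minl; last exact: pruning_code.
(* A code for [G] also serves [G'], since deleting arcs only drops demands. *)
exact: (index_code_lower vE nG' stG' (has_index_code_sub sA codel)).
Qed.
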